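(* Let $\mathcal{L}$ be a regular language over a finite alphabet $\Sigma$, and let $\mathcal{D}_{\mathcal{L}}$ be its minimal DFA, with state set $S$, transition map $\delta$, and initial state $i_0$. Let $M=(m_{vw})_{v,w\in S}$, where $m_{vw}=|\{\sigma\in\Sigma:\delta(v,\sigma)=w\}|$, and let $q:S\to\mathbb{Z}_{>0}$. The following are equivalent: (1) there exists a connected DFA recognizing $\mathcal{L}$ whose Myhill-Nerode equivalence class corresponding to $v$ has size $q(v)$ for every $v\in S$; (2) there exists a quota tree with root $i_0$ and quota $q$ over the directed multigraph of $\mathcal{D}_{\mathcal{L}}$; (3) $[w=i_0]+\sum_{v\in S}q(v)\,m_{vw}\ge q(w)$ for every $w\in S$, where $[w=i_0]$ is $1$ if $w=i_0$ and $0$ otherwise.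
   Context: A DFA is a tuple $\mathcal{D}=(S,\Sigma,\delta,i,a)$ with finite state set $S$, finite alphabet $\Sigma$, transition map $\delta:S\times\Sigma\to S$ (extended in the usual way to $S\times\Sigma^*\to S$), initial state $i\in S$, and set of accept states $a\subset S$. It recognizes the language of all $w\in\Sigma^*$ with $\delta(i,w)\in a$. It is connected if every state is of the form $\delta(i,w)$ for some $w\in\Sigma^*$. Its directed multigraph has vertex set $S$ and, for each $(v,\sigma)\in S\times\Sigma$, one edge from $v$ to $\delta(v,\sigma)$ labeled $\sigma$. Every connected DFA $\mathcal{D}$ recognizing $\mathcal{L}$ has a quotient map $\phi$ from the states of $\mathcal{D}$ onto the states of the minimal DFA $\mathcal{D}_{\mathcal{L}}$ that preserves initial state, accept and non-accept states, and transitions ($\delta(\phi(v),\sigma)=\phi(\delta(v,\sigma))$). The Myhill-Nerode equivalence classes of $\mathcal{D}$ are the sets $\phi^{-1}(v)$, for $v$ a state of $\mathcal{D}_{\mathcal{L}}$. A map of directed multigraphs sends vertices to vertices, edges to edges, and respects initial and terminal vertices; it is an immersion if for every vertex $v$ it is injective on the set of outgoing edges of $v$. A quota tree with root $*\in V(G)$ and quota $q$ over a directed multigraph $G$ is an immersion $f:T\to G$, where $T$ is a finite rooted tree with all edges directed away from its root, such that the root maps to $*$ and $|f^{-1}(v)|=q(v)$ for all $v\in V(G)$. *)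

(* Defs.v *)
From mathcomp Require Import all_boot.
Set Implicit Arguments.
Unset Strict Implicit.
Unset Printing Implicit Defensive.

Section Automata.
Variable Sigma : finType.

Record dfa := Dfa {
  state : finType;
  delta : state -> Sigma -> state;
  init : state;
  accept : {set state}
}.

Definition delta_star (D : dfa) (s : state D) (w : seq Sigma) : state D :=
  foldl (@delta D) s w.

Definition recognizes (D : dfa) (L : seq Sigma -> Prop) : Prop :=
  forall w, delta_star (init D) w \in accept D <-> L w.

Definition regular (L : seq Sigma -> Prop) : Prop :=
  exists D : dfa, recognizes D L.

Definition connected_dfa (D : dfa) : Prop :=
  forall s : state D, exists w, delta_star (init D) w = s.

(* A minimal DFA is one with the fewest states; it is unique up to            *)
(* isomorphism.                                                               *)
Definition minimal_dfa (L : seq Sigma -> Prop) (D : dfa) : Prop :=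
  recognizes D L /\
  forall D' : dfa, recognizes D' L -> #|state D| <= #|state D'|.

Definition quotient_map (D D' : dfa) (phi : state D -> state D') : Prop :=
  [/\ forall v, exists s, phi s = v,
      phi (init D) = init D',
      forall s, (phi s \in accept D') = (s \in accept D)
    & forall s a, delta (phi s) a = phi (delta s a)].

(* When D is connected there is at most one quotient map phi onto a given     *)
(* DFA, so these classes do not depend on the choice of phi.                  *)
Definition myhill_nerode_class (D D' : dfa) (phi : state D -> state D')
    (v : state D') : {set state D} :=
  [set s | phi s == v].

Definition transition_count (D : dfa) (v w : state D) : nat :=
  #|[set a : Sigma | delta v a == w]|.

End Automata.

Record multigraph := Multigraph {
  vertex : finType;
  edge : finType;
  src : edge -> vertex;
  tgt : edge -> vertex
}.

(* The edge (v, a) carries the label a.                                       *)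
Definition dfa_graph (Sigma : finType) (D : dfa Sigma) : multigraph :=
  @Multigraph (state D) (state D * Sigma)%type
    (fun e => e.1) (fun e => delta e.1 e.2).

Record graph_map (T G : multigraph) := GraphMap {
  vmap : vertex T -> vertex G;
  emap : edge T -> edge G;
  src_emap : forall e, src (emap e) = vmap (src e);
  tgt_emap : forall e, tgt (emap e) = vmap (tgt e)
}.

Definition immersion (T G : multigraph) (f : graph_map T G) : Prop :=
  forall v, {in [pred e | src e == v] &, injective (emap f)}.

Section Trees.
Variable T : multigraph.

(* Walks in the underlying undirected multigraph: a step (e, b) traverses e   *)
(* from source to target if b = true, from target to source if b = false.     *)
Definition step : Type := (edge T * bool)%type.
Definition step_src (d : step) : vertex T := if d.2 then src d.1 else tgt d.1.
Definition step_tgt (d : step) : vertex T := if d.2 then tgt d.1 else src d.1.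

Fixpoint walk (x : vertex T) (p : seq step) (y : vertex T) : bool :=
  if p is d :: p' then (step_src d == x) && walk (step_tgt d) p' y else x == y.

Definition simple_walk x p y : bool :=
  walk x p y && uniq (x :: [seq step_tgt d | d <- p]).

(* Distinctness of the edges only matters for closed walks of length two:     *)
(* going back and forth along one edge is not a cycle, whereas two parallel   *)
(* or opposite edges do form one.                                             *)
Definition cycle_walk x p : bool :=
  [&& p != [::], walk x p x, uniq [seq step_tgt d | d <- p]
    & uniq [seq d.1 | d <- p]].

Definition is_tree : Prop :=
  (forall x y, exists p, walk x p y) /\ (forall x p, ~~ cycle_walk x p).

(* In a tree every edge lies on a simple walk starting at r, so every edge    *)
(* is constrained.                                                            *)
Definition directed_away_from (r : vertex T) : Prop :=
  forall p y, simple_walk r p y -> all (fun d => d.2) p.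

End Trees.

Definition is_quota_tree (G : multigraph) (x : vertex G) (q : vertex G -> nat)
    (T : multigraph) (r : vertex T) (f : graph_map T G) : Prop :=
  [/\ is_tree T, directed_away_from r, immersion f, vmap f r = x
    & forall v, #|[set u | vmap f u == v]| = q v].

(* Main.v *)
Require Import Defs.
From mathcomp Require Import all_boot.

(** The implications proved are from quota trees to DFAs, from DFAs to the
    inequalities, and from the inequalities back to quota trees.

    From a quota tree, a DFA is obtained on the vertices of the tree
    ([dfa_of_quota_tree]): a letter follows the tree edge that lies over the
    corresponding transition if there is one, and otherwise leads to any vertex
    over the required state, which exists because the quota is positive. The
    tree edges alone make this DFA connected.

    From a connected DFA, the inequality at [w] is a count of predecessors
    ([dfa_quota_bound]): every state in the class of [w] other than the initial
    one is reached by a letter from some state, and the pairs (state, letter)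
    that lead into the class of [w] number [\sum_v q v * transition_count v w].

    From the inequalities, a quota tree is found among finite sets of words that
    are closed under removal of the last letter; such a set is a tree, whose
    vertices lie over the states that the words reach ([quota_tree_of_words]).
    Start from the empty word and add words greedily without exceeding the
    quota. The claim is that when no word can be added, the quota is attained
    everywhere ([saturated_full]). Suppose that some state is deficient, that
    is, visited fewer times than its quota. Saturation means that each
    transition into a deficient state can be followed inside the tree, from every
    vertex over its source. Hence the visit counts satisfy the inequality at a
    deficient state in the reverse direction, and comparison with the inequality
    for [q] shows that each deficient state has a deficient predecessor. Going
    back along deficient states for any number of steps, then forward again
    inside the tree, gives arbitrarily long words in a finite set. The forward
    path needs a tree vertex over its starting state; there is one over every
    state because the minimal DFA is connected and [q] is positive. *)

Set Implicit Arguments.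
Unset Strict Implicit.
Unset Printing Implicit Defensive.

(** * Walks in a multigraph *)

Section Walks.
Variable T : multigraph.
Implicit Types (x y z : vertex T) (p : seq (step T)).

Lemma walk_cat x y z p1 p2 :
  walk x p1 y -> walk y p2 z -> walk x (p1 ++ p2) z.
Proof.
elim: p1 x => [|d p1 IH] x /=; first by move=> /eqP ->.
by move=> /andP[-> xy] yz /=; exact: IH xy yz.
Qed.

Lemma simple_walk_suffix x y z p :
  simple_walk x p y -> z \in x :: [seq step_tgt d | d <- p] ->
  exists p', simple_walk z p' y.
Proof.
elim: p x => [|d p IH] x.
  by rewrite inE => sp /eqP ->; exists [::].
rewrite inE => sp /orP[/eqP ->|zp]; first by exists (d :: p).
move: sp; rewrite /simple_walk /= => /andP[/andP[_ wp] /andP[_ up]].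
by apply: IH zp; rewrite /simple_walk wp.
Qed.

(** If prepending a step to a simple walk revisits a vertex, the suffix of the
    walk that starts at that vertex is a shortcut. *)
Lemma walk_simple x y p : walk x p y -> exists p', simple_walk x p' y.
Proof.
elim: p x => [|d p IH] x; first by exists [::]; rewrite /simple_walk /= andbT.
move=> /= /andP[/eqP dx /IH[p' sp']].
have [xp'|xp'] := boolP (x \in step_tgt d :: [seq step_tgt d | d <- p']).
  exact: simple_walk_suffix sp' xp'.
exists (d :: p'); move: sp'; rewrite /simple_walk /= dx eqxx /= => /andP[-> /=].
by move: xp'; rewrite inE => -> /=.
Qed.

End Walks.

(** * Rooted trees from height functions

    A height that increases by one along every edge, together with exactly one
    edge into each vertex other than the root, makes a multigraph a tree with
    edges directed away from the root. *)

Section Arborescence.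
Variables (T : multigraph) (r : vertex T) (h : vertex T -> nat).
Implicit Types (x y : vertex T) (p : seq (step T)).
Hypothesis tgt_inj : injective (@tgt T).
Hypothesis h_tgt : forall e : edge T, h (tgt e) = (h (src e)).+1.
Hypothesis h_root : h r = 0.
Hypothesis tgt_onto : forall v, v != r -> exists e : edge T, tgt e = v.

Lemma arborescence_connected x y : exists p, walk x p y.
Proof.
have to_from v : (exists p, walk r p v) /\ (exists p, walk v p r).
  have [n le_vn] := ubnP (h v); elim: n v le_vn => // n IH v.
  have [-> _|/tgt_onto[e <-]] := eqVneq v r; first by split; exists [::] => /=.
  rewrite ltnS h_tgt => /IH[[p rp] [p' pr]]; split.
    exists (p ++ [:: (e, true)]); apply: walk_cat rp _.
    by rewrite /= /step_src /step_tgt /= !eqxx.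
  by exists ((e, false) :: p'); rewrite /= /step_src /step_tgt /= eqxx.
have [_ [p xr]] := to_from x; have [[p' ry] _] := to_from y.
by exists (p ++ p'); exact: walk_cat xr ry.
Qed.

(** Once a walk has descended along the only edge into its current vertex, it
    cannot ascend without reusing that edge. *)
Lemma walk_after_descent e x y p :
  walk x p y -> tgt e = x -> e \notin [seq d.1 | d <- p] ->
  uniq [seq d.1 | d <- p] -> all (fun d => d.2) p.
Proof.
elim: p e x => //= -[g b] p IH e x /andP[/eqP gx wp] ex.
rewrite inE negb_or => /andP[/= neg _] /andP[gp up].
case: b gx wp => /= gx wp; first exact: IH wp _ gp up.
by move: neg; rewrite (tgt_inj (etrans ex (esym gx))) eqxx.
Qed.

(** The mirror image of [walk_after_descent]: the last descent would have to be
    followed by an ascent along the same edge, or end at [y] along [e]. *)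
Lemma walk_before_ascent e x y p :
  walk x p y -> tgt e = y -> e \notin [seq d.1 | d <- p] ->
  uniq [seq d.1 | d <- p] -> all (fun d => ~~ d.2) p.
Proof.
elim: p x => //= -[g b] p IH x /andP[_ wp] ey.
rewrite inE negb_or => /andP[/= neg ep] /andP[gp up].
have up_p := IH _ wp ey ep up; rewrite up_p andbT.
case: b wp => // wp; case: p wp up_p gp {IH ep up} => [/eqP gy|[g' b'] p] /=.
  by move: neg; rewrite (tgt_inj (etrans ey (esym gy))) eqxx.
case: b' => //= /andP[/eqP g'g _] _.
by rewrite inE (tgt_inj (g'g : tgt g' = tgt g)) eqxx.
Qed.

Lemma height_descent x y p : walk x p y -> all (fun d => d.2) p -> h x <= h y.
Proof.
elim: p x => [x /eqP -> //|[g b] p IH x] /= /andP[/eqP <- wp] /andP[b_true ap].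
apply: leq_trans (IH _ wp ap).
by rewrite /step_src /step_tgt /= b_true h_tgt.
Qed.

Lemma height_ascent x y p : walk x p y -> all (fun d => ~~ d.2) p -> h y <= h x.
Proof.
elim: p x => [x /eqP -> //|[g b] p IH x] /= /andP[/eqP <- wp] /andP[bF ap].
apply: leq_trans (IH _ wp ap) _.
by rewrite /step_src /step_tgt /= (negbTE bF) h_tgt.
Qed.

(** The first step of a cycle forces the direction of all the others: a descent
    can only be followed by descents, and after an ascent along the edge into
    [x] the walk can return to [x] only by ascents. Either way the height
    changes strictly, so the walk does not close up. *)
Lemma arborescence_acyclic x p : ~~ cycle_walk x p.
Proof.
apply/negP => /and4P[]; case: p => // -[g b] p _ /=.
rewrite {1}/step_src {1}/step_tgt /=.
case: b => /andP[/eqP gx wp] _ /andP[gp up].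
  have := height_descent wp (walk_after_descent wp erefl gp up).
  by rewrite -gx h_tgt ltnn.
have := height_ascent wp (walk_before_ascent wp gx gp up).
by rewrite -gx h_tgt ltnn.
Qed.

(** A simple walk can never ascend: from the root there is no edge to ascend,
    and after a descent an ascent would return to the previous vertex. *)
Lemma arborescence_directed : directed_away_from r.
Proof.
(* The induction hypothesis records that the parent of the current vertex, if
   any, is not visited later. *)
suff away x p y : simple_walk x p y ->
    (forall e, tgt e = x -> src e \notin [seq step_tgt d | d <- p]) ->
    all (fun d => d.2) p.
  move=> p y /away; apply=> e er.
  by move: (h_tgt e); rewrite er h_root.
elim: p x => //= -[g b] p IH x.
rewrite /simple_walk {1}[walk _ _ _]/= {1}/step_src {1}/step_tgt /=.
move=> /andP[/andP[/eqP gx wp] /andP[xp up]] no_back.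
case: b gx wp xp up no_back => /= gx wp xp up no_back; last first.
  by have := no_back _ gx; rewrite inE eqxx.
apply: (IH (tgt g)); first by rewrite /simple_walk wp.
by move=> e /tgt_inj ->; move: xp; rewrite gx inE negb_or => /andP[].
Qed.

Lemma arborescence_tree : is_tree T.
Proof. by split; [exact: arborescence_connected|exact: arborescence_acyclic]. Qed.

End Arborescence.

(** * From connected DFAs to the inequalities *)

Lemma sum_fibers (I : Type) (J : finType) (s : seq I) (f : I -> J)
    (F : J -> nat) :
  \sum_(x <- s) F (f x) = \sum_v count (fun x => f x == v) s * F v.
Proof.
rewrite (partition_big f xpredT) //=; apply: eq_bigr => v _.
rewrite (eq_bigr (fun=> F v)) => [|x /eqP -> //].
by rewrite big_const_seq iter_addn_0 mulnC.
Qed.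

Section Automata.
Variable Sigma : finType.
Implicit Types (D : dfa Sigma) (L : seq Sigma -> Prop).

(** The reachable states form a DFA for the same language, so by minimality
    there are no others. *)
Lemma minimal_dfa_connected L D : minimal_dfa L D -> connected_dfa D.
Proof.
move=> [recD minD].
pose e := [rel s t : state D | [exists a, delta s a == t]].
pose reach s := connect e (init D) s.
have reach_delta (s : {s | reach s}) a : reach (delta (val s) a).
  apply: connect_trans (valP s) (connect1 _).
  by apply/existsP; exists a.
pose R := @Dfa Sigma {s | reach s} (fun s a => Sub _ (reach_delta s a))
  (Sub _ (connect0 e (init D))) [set s | val s \in accept D].
have val_run w (s : state R) : val (delta_star s w) = delta_star (val s) w.
  by elim: w s => //= a w IH s; rewrite IH.
have recR : recognizes R L.
  by move=> w; rewrite inE val_run; exact: recD.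
move=> s.
have : reach s.
  have := minD R recR; rewrite /= card_sig => le_card.
  have : s \in [set s | reach s]; last by rewrite inE.
  suff /eqP -> : [set s | reach s] == [set: state D] by rewrite inE.
  by rewrite eqEcard subsetT cardsT cardsE.
case/connectP => p; elim/last_ind: p s => [|p t IH] s /=.
  by move=> _ ->; exists [::].
rewrite rcons_path last_rcons => /andP[ep /existsP[a /eqP at_]] ->.
have [w ws] := IH _ ep erefl; exists (rcons w a).
by rewrite /delta_star foldl_rcons -/(delta_star _ _) ws.
Qed.

(** Every non-initial state in the class of [w] is the image under [delta] of a
    pair (state, letter) that leads into this class; the term [w == init DL]
    accounts for the initial state. *)
Lemma dfa_quota_bound D DL (phi : state D -> state DL) (q : state DL -> nat) :
  connected_dfa D -> quotient_map phi ->
  (forall v, #|myhill_nerode_class phi v| = q v) ->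
  forall w, q w <= (w == init DL) + \sum_v q v * transition_count v w.
Proof.
move=> conD [_ phi_i _ phi_d] card_phi w.
rewrite -card_phi (cardsD1 (init D)) inE phi_i eq_sym leq_add2l.
pose A := [set sa : state D * Sigma | delta (phi sa.1) sa.2 == w].
have sub : myhill_nerode_class phi w :\ init D
    \subset [set delta sa.1 sa.2 | sa in A].
  apply/subsetP => s; rewrite !inE => /andP[s_ni /eqP sw].
  have [u us] := conD s; elim/last_ind: u us => [|u a _] us.
    by rewrite -us eqxx in s_ni.
  rewrite /delta_star foldl_rcons -/(delta_star _ _) in us.
  apply/imsetP; exists (delta_star (init D) u, a); rewrite ?us //.
  by rewrite inE /= phi_d us sw.
apply: leq_trans (subset_leq_card sub) (leq_trans (leq_imset_card _ _) _).
rewrite -sum1_card (eq_bigl (fun sa => delta (phi sa.1) sa.2 == w)); last first.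
  by move=> sa; rewrite inE.
rewrite -(pair_big_dep xpredT (fun s a => delta (phi s) a == w) (fun _ _ => 1)) /=.
rewrite (eq_bigr (fun s => transition_count (phi s) w)); last first.
  by move=> s _; rewrite sum1_card /transition_count cardsE.
rewrite (sum_fibers _ phi (fun v => transition_count v w)).
apply: leq_sum => v _; rewrite -card_phi -sum1_count -sum1_card.
apply: leq_mul => //; apply: eq_leq; apply: eq_bigl => s.
by rewrite inE.
Qed.

(** * From quota trees to connected DFAs *)

Section DfaOfTree.
Variables (DL : dfa Sigma) (T : multigraph) (f : graph_map T (dfa_graph DL)).
Variable r : vertex T.

(** The default value [s] is never taken when [vmap f] is onto. *)
Definition tree_delta (s : vertex T) (a : Sigma) : vertex T :=
  if [pick e | (src e == s) && ((emap f e : state DL * Sigma).2 == a)] is Some e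
  then tgt e
  else if [pick u | vmap f u == delta (vmap f s : state DL) a] is Some u
  then u else s.

Definition tree_dfa : dfa Sigma :=
  @Dfa Sigma (vertex T) tree_delta r [set s | vmap f s \in accept DL].

Lemma vmap_tree_delta : (forall v, exists u, vmap f u = v) ->
  forall s a, vmap f (tree_delta s a) = delta (vmap f s : state DL) a.
Proof.
move=> f_onto s a; rewrite /tree_delta.
case: pickP => [e /andP[/eqP <- /eqP <-]|_].
  by rewrite -tgt_emap -src_emap.
case: pickP => [u /eqP //|noU].
have [u fu] := f_onto (delta (vmap f s : state DL) a).
by have := noU u; rewrite fu eqxx.
Qed.

(** Since [f] is an immersion, the edge picked by [tree_delta] is the only one
    with its source and label. *)
Lemma tree_delta_edge e : immersion f ->
  tree_delta (src e) (emap f e : state DL * Sigma).2 = tgt e.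
Proof.
move=> imm; rewrite /tree_delta; case: pickP => [e' /andP[/eqP se /eqP le]|].
  congr tgt; apply: (imm (src e)); rewrite ?inE ?se //.
  have := src_emap f e; have := src_emap f e'; rewrite /= se => <-.
  by case: (emap f e) (emap f e') le => [? ?] [? ?] /= -> ->.
by move/(_ e); rewrite !eqxx.
Qed.

(** A walk from the root can be made simple, hence directed, and then its labels
    spell a word that reaches the end of the walk. *)
Lemma tree_dfa_connected : is_tree T -> directed_away_from r -> immersion f ->
  connected_dfa tree_dfa.
Proof.
move=> [conT _] away imm s.
have [p /walk_simple[p' sp']] := conT r s.
have down := away _ _ sp'; case/andP: sp' => wp _.
exists [seq (emap f d.1 : state DL * Sigma).2 | d <- p'].
rewrite [init _]/=; move: r wp down => {away} x; elim: p' x => [|[e b] p' IH] x /=.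
  by move=> /eqP.
move=> /andP[/eqP <- wp] /andP[b_true down]; move: wp.
by rewrite /step_src /step_tgt /= b_true tree_delta_edge // => wp; exact: IH.
Qed.

End DfaOfTree.

Lemma dfa_of_quota_tree L DL (q : state DL -> nat) :
  recognizes DL L -> (forall v, 0 < q v) ->
  (exists (T : multigraph) (r : vertex T) (f : graph_map T (dfa_graph DL)),
    @is_quota_tree (dfa_graph DL) (init DL) q T r f) ->
  exists (D : dfa Sigma) (phi : state D -> state DL),
    [/\ connected_dfa D, recognizes D L, quotient_map phi
      & forall v, #|myhill_nerode_class phi v| = q v].
Proof.
move=> recDL q_gt0 [T [r [f [treeT away imm fr quota]]]].
have f_onto v : exists u, vmap f u = v.
  have : 0 < #|[set u | vmap f u == v]| by rewrite quota.
  by case/card_gt0P => u; rewrite inE => /eqP; exists u.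
have f_delta := vmap_tree_delta f_onto.
exists (tree_dfa f r), (vmap f); split=> //.
- exact: tree_dfa_connected.
- have f_run w (s : state (tree_dfa f r)) :
      vmap f (delta_star s w) = delta_star (vmap f s : state DL) w.
    by elim: w s => //= a w IH s; rewrite IH f_delta.
  by move=> w; rewrite inE f_run fr; exact: recDL.
- by split=> // s; [rewrite inE | move=> a; rewrite f_delta].
Qed.

(** * From the inequalities to quota trees *)

Section Words.
Variable D : dfa Sigma.
Implicit Types (P : seq (seq Sigma)) (x : seq Sigma) (v w : state D).

(** Words are read from right to left, so that the last letter read is the head
    of the list and the parent of [a :: x] is [x]. *)
Definition run x : state D := foldr (fun a s => delta s a) (init D) x.

Definition visits P v := count (fun x => run x == v) P.

Definition word_tree P :=
  [/\ uniq P, [::] \in P & forall a x, a :: x \in P -> x \in P].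

(** ** The quota tree of a suffix-closed set of words *)

Section TreeOfWords.
Variable P : seq (seq Sigma).
Hypothesis treeP : word_tree P.

(** An edge is a pair of a letter and a vertex whose extension by the letter is
    again a vertex; distinct edges with the same source have distinct letters,
    which is what makes [word_graph_map] an immersion. *)
Definition word_graph : multigraph :=
  @Multigraph (seq_sub P) {ax : Sigma * seq_sub P | ax.1 :: val ax.2 \in P}
    (fun e => (val e).2) (fun e => SeqSub (valP e)).

Lemma word_graph_mapP (e : edge word_graph) :
  delta (run (val (src e))) (val e).1 = run (val (tgt e)).
Proof. by []. Qed.

Definition word_graph_map : graph_map word_graph (dfa_graph D) :=
  @GraphMap word_graph (dfa_graph D) (fun x : seq_sub P => run (val x))
    (fun e : edge word_graph => (run (val (src e)), (val e).1))
    (fun _ => erefl) word_graph_mapP.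

(** The length of a word serves as its height. *)
Lemma quota_tree_of_words :
  exists r : vertex word_graph,
    is_quota_tree (init D : vertex (dfa_graph D)) (visits P) r word_graph_map.
Proof.
have [uP nilP sufP] := treeP; pose r : vertex word_graph := SeqSub nilP.
have arb_inj : injective (@tgt word_graph).
  move=> [[a [x px]] pax] [[b [y py]] pby] /(congr1 val) /= [ab xy].
  by apply: val_inj; congr pair => //; apply: val_inj.
have arb_h e : size (val (tgt e : vertex word_graph)) = (size (val (src e))).+1 by [].
have arb_onto (v : vertex word_graph) : v != r -> exists e : edge word_graph, tgt e = v.
  case: v => -[|a x] pax; first by case/eqP; apply: val_inj.
  move=> _; pose ax : Sigma * seq_sub P := (a, SeqSub (sufP _ _ pax)).
  by exists (exist (fun ax => ax.1 :: val ax.2 \in P) ax pax); apply: val_inj.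
exists r; split=> //.
- exact: (@arborescence_tree _ r (fun x : seq_sub P => size (val x))).
- exact: (@arborescence_directed _ r (fun x : seq_sub P => size (val x))).
- move=> v [[a x] pe] [[b y] pe']; rewrite !inE /= => /eqP xv /eqP yv [_ ab].
  by apply: val_inj; rewrite /= ab; congr pair; exact: etrans xv (esym yv).
- move=> v; rewrite /visits -size_filter cardE -(size_map val).
  apply: perm_size; apply: uniq_perm.
  + by rewrite (map_inj_uniq val_inj) enum_uniq.
  + exact: filter_uniq.
  + move=> x; rewrite mem_filter; apply/mapP/andP => [[u]|[xv px]].
      by rewrite mem_enum inE => uv ->; split=> //; exact: valP.
    by exists (SeqSub px); rewrite ?mem_enum ?inE.
Qed.

End TreeOfWords.

(** ** Greedy growth up to the quota *)

Variable q : state D -> nat.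

(** The greedy growth is stuck: adding another child of a word of [P] would
    exceed the quota [q]. *)
Definition saturated P := forall a x, x \in P ->
  visits P (delta (run x) a) < q (delta (run x) a) -> a :: x \in P.

(** By saturation every word of [P] followed by a transition into [w] is again
    in [P]; these words, and the empty one if [w] is initial, are pairwise
    distinct and reach [w]. *)
Lemma saturated_visits P w : word_tree P -> saturated P -> visits P w < q w ->
  (w == init D) + \sum_v visits P v * transition_count v w <= visits P w.
Proof.
move=> [uP nilP _] satP wq.
pose ext x := [seq a <- enum Sigma | delta (run x) a == w].
pose Q := nseq (w == init D) [::] ++ [seq a :: x | x <- P, a <- ext x].
rewrite -(sum_fibers _ run (fun v => transition_count v w)).
have -> : (w == init D) + \sum_(x <- P) transition_count (run x) w = size Q.
  rewrite size_cat size_nseq size_allpairs_dep sumnE big_map.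
  congr addn; apply: eq_bigr => x _.
  rewrite /transition_count cardE /ext {1}/enum_mem -enumT.
  rewrite (eq_filter (a2 := fun a => delta (run x) a == w)) // => a.
  by rewrite /= inE.
rewrite /visits -size_filter; apply: uniq_leq_size.
  rewrite cat_uniq allpairs_uniq_dep // ?andbT; last first.
  - by move=> [x a] [y b] _ _ /= [-> ->].
  - by move=> x _; rewrite filter_uniq ?enum_uniq.
  apply/andP; split; first by case: eqP.
  by apply/hasPn => z /allpairsPdep[x [a [_ _ ->]]]; case: eqP.
move=> z; rewrite mem_cat mem_filter => /orP[|/allpairsPdep[x [a [px]]]].
  by case: eqP => // ->; rewrite inE => /eqP ->; rewrite /= eqxx.
rewrite mem_filter => /andP[/eqP aw _] ->.
by rewrite /= aw eqxx satP ?aw.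
Qed.

Hypothesis q_gt0 : forall v, 0 < q v.
Hypothesis conD : connected_dfa D.

(** Along a path from the initial state, either the next state is deficient and
    the word over the current state extends within [P], or its quota is met and
    hence its number of visits is positive. *)
Lemma saturated_visited P v : word_tree P -> saturated P ->
  exists2 x, x \in P & run x = v.
Proof.
move=> [_ nilP _] satP.
have [u <-] := conD v; elim/last_ind: u {v} => [|u a [x px xu]].
  by exists [::].
rewrite /delta_star foldl_rcons -/(delta_star _ _) -xu.
have [lt_q|ge_q] := ltnP (visits P (delta (run x) a)) (q (delta (run x) a)).
  by exists (a :: x) => //; exact: satP.
have : 0 < visits P (delta (run x) a) by exact: leq_trans (q_gt0 _) ge_q.
by rewrite -has_count => /hasP[y py /eqP]; exists y.
Qed.

Hypothesis q_le : forall w,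
  q w <= (w == init D) + \sum_v q v * transition_count v w.

(** Subtracting the bound of [saturated_visits] from the one for [q] shows that
    [\sum_v (q v - visits P v) * transition_count v w] is positive. *)
Lemma deficient_predecessor P w : word_tree P -> saturated P ->
  visits P w < q w -> exists v a, visits P v < q v /\ delta v a = w.
Proof.
move=> treeP satP wq.
have [/existsP[v /andP[vq /card_gt0P[a]]]|none] :=
    boolP [exists v, (visits P v < q v) && (0 < transition_count v w)].
  by rewrite inE => /eqP; exists v, a.
have := leq_ltn_trans (saturated_visits treeP satP wq) (leq_trans wq (q_le w)).
rewrite ltn_add2l ltnNge leq_sum // => v _; move: none.
rewrite negb_exists => /forallP /(_ v); rewrite negb_and -leqNgt -eqn0Ngt.
by rewrite leq_mul2r orbC.
Qed.

(** A deficient state would have a deficient predecessor, and so on; following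
    such a chain forward stays inside [P] by saturation and gives words of
    unbounded length in the finite set [P]. *)
Lemma saturated_full P : word_tree P -> saturated P ->
  (forall w, visits P w <= q w) -> forall w, visits P w = q w.
Proof.
move=> treeP satP le_q w; apply/eqP; rewrite eqn_leq le_q /= leqNgt.
apply/negP => wq.
have long n v : visits P v < q v -> exists x, [/\ x \in P, run x = v & n <= size x].
  elim: n v => [v _|n IH v vq].
    by have [x px xv] := saturated_visited v treeP satP; exists x.
  have [u [a [uq au]]] := deficient_predecessor treeP satP vq.
  have [x [px xu nx]] := IH u uq; exists (a :: x); split=> //=; last by rewrite xu.
  by apply: satP; rewrite // xu au.
have [x [px _]] := long (\max_(x <- P) size x).+1 w wq.
by rewrite ltnNge leq_bigmax_seq.
Qed.

(** Words are added until the set is saturated, which happens because its size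
    is at most the total quota. *)
Lemma word_tree_exists :
  exists2 P, word_tree P & forall v, visits P v = q v.
Proof.
suff grow n P : word_tree P -> (forall v, visits P v <= q v) ->
    \sum_v q v < size P + n ->
    exists2 P, word_tree P & forall v, visits P v = q v.
  apply: (grow (\sum_v q v).+1 [:: [::]]); last by rewrite addnS ltnS leq_addl.
    by split=> // a x; rewrite inE.
  by move=> v; rewrite /visits /= addn0; case: eqP => // _; exact: q_gt0.
elim: n P => [|n IH] P treeP le_q small.
  have : size P <= \sum_v q v.
    rewrite -sum1_size (sum_fibers _ run (fun=> 1)).
    by apply: leq_sum => v _; rewrite muln1; exact: le_q.
  by rewrite leqNgt -[size P]addn0 small.
have [uP nilP sufP] := treeP.
pose new x a := (visits P (delta (run x) a) < q (delta (run x) a))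
  && (a :: x \notin P).
have [/hasP[x px /existsP[a /andP[deficient fresh]]]|none] :=
    boolP (has (fun x => [exists a, new x a]) P); last first.
  exists P => //; apply: saturated_full => // a x px deficient.
  move/hasPn/(_ x px): none; rewrite negb_exists => /forallP/(_ a).
  by rewrite negb_and deficient negbK.
apply: (IH ((a :: x) :: P)); last by rewrite /= addSnnS.
  split; rewrite /= ?inE ?fresh ?nilP ?orbT // => b y.
  rewrite !inE => /orP[/eqP[_ ->]|/sufP ->]; last exact: orbT.
  by rewrite px orbT.
move=> v; rewrite /visits /= -/(visits P v).
by case: eqP => [<-|_] //=; rewrite add0n.
Qed.

End Words.

End Automata.

Theorem mainTheorem4 (Sigma : finType) (L : seq Sigma -> Prop)
    (hL : regular L)
    (DL : dfa Sigma) (hDL : minimal_dfa L DL)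
    (q : state DL -> nat) (hq : forall v, 0 < q v) :
  ((exists (D : dfa Sigma) (phi : state D -> state DL),
      [/\ connected_dfa D, recognizes D L, quotient_map phi
        & forall v, #|myhill_nerode_class phi v| = q v])
   <->
   (exists (T : multigraph) (r : vertex T) (f : graph_map T (dfa_graph DL)),
      @is_quota_tree (dfa_graph DL) (init DL) q T r f))
  /\
  ((exists (T : multigraph) (r : vertex T) (f : graph_map T (dfa_graph DL)),
      @is_quota_tree (dfa_graph DL) (init DL) q T r f)
   <->
   (forall w : state DL,
      q w <= (w == init DL) + \sum_(v : state DL) q v * transition_count v w)).
Proof.
have of_tree := dfa_of_quota_tree hDL.1 hq.
have bound D (phi : state D -> state DL) : [/\ connected_dfa D, recognizes D L,
    quotient_map phi & forall v, #|myhill_nerode_class phi v| = q v] ->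
    forall w, q w <= (w == init DL) + \sum_v q v * transition_count v w.
  by move=> [conD _ quoD cardD]; exact: dfa_quota_bound cardD.
have to_tree : (forall w, q w <=
    (w == init DL) + \sum_v q v * transition_count v w) ->
    exists (T : multigraph) (r : vertex T) (f : graph_map T (dfa_graph DL)),
      @is_quota_tree (dfa_graph DL) (init DL) q T r f.
  move=> q_le; have conDL := minimal_dfa_connected hDL.
  have [P treeP visitsP] := word_tree_exists hq conDL q_le.
  have [r [isT away imm fr quota]] := quota_tree_of_words DL treeP.
  exists (word_graph P), r, (word_graph_map DL P); split=> // v.
  by rewrite quota.
split; split=> //.
  by move=> [D [phi /bound]].
by move=> /of_tree[D [phi /bound]].
Qed.
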